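(* Assume that $a(r)=1/r$ for $r>0$. Let $M>0$, $m_0\in(0,M)$, and let $u_0\in C([0,1])$ be a non-negative function such that $u_0\ge m_0>0$ and $\langle u_0\rangle=M$. Let $(u,v)$ be the corresponding maximal classical solution to the quasilinear Smoluchowski-Poisson system with diffusion coefficient $a$ and initial condition $u_0$, with maximal existence time $T_{max}\in(0,\infty]$. Then $T_{max}=\infty$, the trajectory $\{(u(t),v(t)) : t\ge0\}$ is bounded in $L^\infty(0,1;\mathbb{R}^2)$, and there is $\mu>0$ such that $u(t,x)\ge\mu$ for all $(t,x)\in[0,\infty)\times[0,1]$.
   Context: For an integrable function $g$ on a bounded interval $I$, $\langle g\rangle:=\frac{1}{|I|}\int_I g(x)\,dx$. Given a positive $a\in C^1((0,\infty))$ with indefinite integral $A$ (i.e. $A'=a$) and $u_0\in C([0,1])$ with $M=\langle u_0\rangle$, the one-dimensional quasilinear Smoluchowski-Poisson system on $(0,T)\times(0,1)$ is $$\partial_t u=\partial_x\big(a(u)\,\partial_x u-u\,\partial_x v\big),\qquad 0=\partial_x^2 v+u-M\quad\text{in }(0,T)\times(0,1),$$ $$\partial_x A(u)(t,0)=\partial_x A(u)(t,1)=\partial_x v(t,0)=\partial_x v(t,1)=0\quad\text{for } t\in(0,T),$$ $$u(0)=u_0\ \text{ in }(0,1),\qquad \langle v(t)\rangle=0\ \text{ for } t\in(0,T).$$ When $u_0\ge m_0>0$ with $m_0\in(0,M)$, the corresponding maximal classical solution is the unique pair $(u,v)\in C([0,T_{max})\times[0,1];\mathbb{R}^2)\cap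 C^{1,2}((0,T_{max})\times[0,1];\mathbb{R}^2)$ solving the system on $[0,T_{max})$, with $\langle u(t)\rangle=M$ and $u(t,x)\ge \frac{Mm_0}{m_0+e^{Mt}(M-m_0)}>0$ for all $(t,x)\in[0,T_{max})\times[0,1]$, where $T_{max}\in(0,\infty]$ is the maximal existence time: if $T_{max}<\infty$, then $\|u(t)\|_{L^\infty(0,1)}\to\infty$ as $t\to T_{max}$. Here $C^{1,2}$ means continuously differentiable once in time $t$ and twice in space $x$. *)

(* Defs.v *)
From HB Require Import structures.
From mathcomp Require Import all_boot all_order all_algebra.
From mathcomp Require Import all_classical all_reals all_analysis.

Set Implicit Arguments.
Unset Strict Implicit.
Unset Printing Implicit Defensive.

Import Order.TTheory GRing.Theory Num.Theory.
Import numFieldTopology.Exports numFieldNormedType.Exports.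

Local Open Scope classical_set_scope.
Local Open Scope ring_scope.

Definition mean (R : realType) (I : set R) (g : R -> R) : R :=
  (fine (lebesgue_measure I))^-1 * \int[lebesgue_measure]_(x in I) g x.

Definition indefinite_integral (R : realType) (a A : R -> R) : Prop :=
  forall r : R, 0 < r -> is_derive r 1 A (a r).

(* L^oo(D)-norm: since f is extended by 0 outside D, the essential supremum
   over the whole line is the one over D. *)
Definition Linf_norm (R : realType) (V : normedModType R) (D : set R)
    (f : R -> V) : \bar R :=
  Lnorm (@lebesgue_measure R) +oo%E (EFin \o ((fun x => `|f x|) \_ D)).

Definition bounded_in_Linf (R : realType) (D : set R)
    (F : set (R -> R * R)) : Prop :=
  exists C : R, forall f, F f ->
    measurable_fun D f /\ (Linf_norm D f <= C%:E)%E.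

(* Space derivatives on [0, 1]: the difference quotient is only taken at points
   of [0, 1], so they are one-sided at 0 and 1 and the usual ones on ]0, 1[. *)
Definition dx_quotient (R : realType) (f : R -> R) (x y : R) : R :=
  (f y - f x) / (y - x).

Definition x_derivable (R : realType) (f : R -> R) (x : R) : Prop :=
  cvg (dx_quotient f x @ within `[0, 1] x^').

Definition dx (R : realType) (f : R -> R) (x : R) : R :=
  lim (dx_quotient f x @ within `[0, 1] x^').

Definition dt (R : realType) (w : R -> R -> R) (t x : R) : R :=
  derive1 (w^~ x) t.

(* [0, T) and (0, T) for T in (0, +oo] *)
Definition times_co (R : realType) (T : \bar R) : set R :=
  [set t | 0 <= t /\ (t%:E < T)%E].

Definition times_oo (R : realType) (T : \bar R) : set R :=
  [set t | 0 < t /\ (t%:E < T)%E].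

Definition continuous_on2 (R : realType) (Q : set (R * R))
    (w : R -> R -> R) : Prop :=
  {within Q, continuous (fun p : R * R => w p.1 p.2)}.

(* w \in C^{1,2}((0, T) x [0, 1]); functions are written w t x. *)
Definition C12 (R : realType) (T : \bar R) (w : R -> R -> R) : Prop :=
  let Q := times_oo T `*` `[0, 1] in
  (forall t x, Q (t, x) ->
    [/\ derivable (w^~ x) t 1,
        x_derivable (w t) x
      & x_derivable (dx (w t)) x]) /\
  [/\ continuous_on2 Q w,
      continuous_on2 Q (dt w),
      continuous_on2 Q (fun t => dx (w t))
    & continuous_on2 Q (fun t => dx (dx (w t)))].

Definition solves_SP (R : realType) (a A : R -> R) (M : R) (u0 : R -> R)
    (T : \bar R) (u v : R -> R -> R) : Prop :=
  [/\ forall t x : R, times_oo T t -> x \in `]0, 1[ ->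
        dt u t x = dx (fun y => a (u t y) * dx (u t) y - u t y * dx (v t) y) x
        /\ 0 = dx (dx (v t)) x + u t x - M,
      forall t, times_oo T t ->
        [/\ dx (A \o u t) 0 = 0, dx (A \o u t) 1 = 0,
            dx (v t) 0 = 0 & dx (v t) 1 = 0],
      forall x : R, x \in `]0, 1[ -> u 0 x = u0 x
    & forall t, times_oo T t -> mean `[0, 1] (v t) = 0].

(* Maximality of T is expressed by the blow-up alternative, which rules out any
   extension that is continuous up to t = T. *)
Definition maximal_classical_solution (R : realType) (a A : R -> R) (M m0 : R)
    (u0 : R -> R) (Tmax : \bar R) (u v : R -> R -> R) : Prop :=
  [/\ (0 < Tmax)%E,
      [/\ continuous_on2 (times_co Tmax `*` `[0, 1]) u,
          continuous_on2 (times_co Tmax `*` `[0, 1]) v,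
          C12 Tmax u & C12 Tmax v],
      solves_SP a A M u0 Tmax u v,
      forall t, times_co Tmax t -> mean `[0, 1] (u t) = M /\
        forall x : R, x \in `[0, 1] ->
          M * m0 / (m0 + expR (M * t) * (M - m0)) <= u t x
    & (Tmax < +oo)%E ->
        Linf_norm `]0, 1[ (u t) @[t --> (fine Tmax)^'-] --> +oo%E].

(* Main.v *)
(** The functional [L(u) = \int u_x^2 / (2 u^3) - \int u ln u] is nonincreasing
    along the flow: with [K = u_x / u^2 - v_x], so that [u_t = (u K)_x], one has
    [dL/dt = - \int K_x^2].  Once [L] is bounded, AM-GM gives
    [|ln u - ln M| <= \int |u_x| / u <= (2 M)^-1 D + M^2] with
    [D = \int u_x^2 / (2 u^3)], hence [\int u ln u <= M ln M + D / 2 + M^3]; this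
    is absorbed by [D] in [L], and [u] is bounded above and away from [0].
    Since [u] is only [C^{1,2}] and continuous at [t = 0], [L] is used from a
    positive time on, and its time derivative is computed without mixed
    derivatives of [u]. *)

Require Import Defs.
From HB Require Import structures.
From mathcomp Require Import all_boot all_order all_algebra.
From mathcomp Require Import all_classical all_reals all_analysis.
From mathcomp Require Import ess_sup_inf measurable_realfun ring lra.

Import Order.TTheory GRing.Theory Num.Theory.
Import numFieldTopology.Exports numFieldNormedType.Exports.

Local Open Scope classical_set_scope.
Local Open Scope ring_scope.

(** * Integrals over compact intervals *)

(** With [w = -2 / sqrt u] one has [w_x^2 / 2 = u_x^2 / (2 u^3)], so [L] is a Dirichlet energy of
    [w] minus an entropy. This substitution is what avoids mixed derivatives: the increment in time
    of a Dirichlet energy involves only [w_t] and [w_xx], which both exist and are jointly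
    continuous. Monotonicity of [L] alone bounds nothing, because the entropy enters with a minus
    sign. What saves the argument is that [u] keeps the mean [M], so that [ln u] equals [ln M]
    somewhere and the entropy is at most [D / 2] plus a constant, whatever the size of [M]. The
    resulting bounds do not depend on the length of the time interval, hence they contradict the
    blow-up alternative when the maximal time is finite. The same bounds control [v], through two
    integrations in space. *)

Lemma within_itvcc_integrable (R : realType) (a b : R) (f : R -> R) :
  {within `[a, b], continuous f} ->
  (@lebesgue_measure R).-integrable `[a, b] (EFin \o f).
Proof.
move=> cf; apply: continuous_compact_integrable => //; exact: segment_compact.
Qed.

Lemma Rintegral_is_derive (R : realType) (f F : R -> R) (a b : R) : a < b ->
  {within `[a, b], continuous f} -> {within `[a, b], continuous F} ->
  (forall x, x \in `]a, b[ -> is_derive x 1 F (f x)) ->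
  \int[lebesgue_measure]_(x in `[a, b]) f x = F b - F a.
Proof.
move=> ab cf cF dF; rewrite /Rintegral (@continuous_FTC2 _ f F)//.
- have [_ Fa Fb] := (continuous_within_itvP F ab).1 cF.
  by split => // x xab; have [] := dF x xab.
- by move=> x xab; rewrite derive1E; have [] := dF x xab.
Qed.

(** The fundamental theorem is applied between the two points, and the interval is then enlarged to
    [[a, b]], which is harmless because [g] dominates [|f|] and so is non-negative. In the
    applications one of the points is chosen where the value of [F] is known. *)
Lemma dist_le_Rintegral_derive (R : realType) (F f g : R -> R) (a b : R) :
  a < b ->
  {within `[a, b], continuous F} -> {within `[a, b], continuous f} ->
  {within `[a, b], continuous g} ->
  (forall x, x \in `]a, b[ -> is_derive x 1 F (f x)) ->
  (forall x, x \in `[a, b] -> `|f x| <= g x) ->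
  forall x y, x \in `[a, b] -> y \in `[a, b] ->
  `|F x - F y| <= \int[lebesgue_measure]_(x in `[a, b]) g x.
Proof.
move=> ab cF cf cg dF fg x y; wlog yx : x y / y <= x.
  move=> H xab yab; case: (leP y x) => [yx|/ltW xy]; first exact: H.
  by rewrite distrC; exact: H.
move: yx; rewrite le_eqVlt => /predU1P[-> _ _|yx].
  rewrite subrr normr0; apply: Rintegral_ge0 => z zab.
  by rewrite (le_trans _ (fg z zab)).
rewrite !in_itv/= => /andP[ax xb] /andP[ay yb].
have sub : `[y, x] `<=` `[a, b].
  by move=> z/=; rewrite !in_itv/= => /andP[yz zx]; lra.
have cf' := continuous_subspaceW sub cf.
have cg' := continuous_subspaceW sub cg.
have if' := within_itvcc_integrable _ _ _ _ cf'.
have ig' := within_itvcc_integrable _ _ _ _ cg'.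
have ig := within_itvcc_integrable _ _ _ _ cg.
have dF' z : z \in `]y, x[ -> is_derive z 1 F (f z).
  by rewrite in_itv/= => /andP[? ?]; apply: dF; rewrite in_itv/=; lra.
have cF' := continuous_subspaceW sub cF.
have <- := @Rintegral_is_derive R f F y x yx cf' cF' dF'.
apply: (le_trans (le_normr_Rintegral _ if')) => //.
apply: (@le_trans _ _ (\int[lebesgue_measure]_(z in `[y, x]) g z)).
  apply: le_Rintegral => //; last by move=> z zyx; exact/fg/sub.
  exact: (integrable_norm if').
rewrite /Rintegral fine_le//.
- exact: integrable_fin_num ig'.
- exact: integrable_fin_num ig.
apply: ge0_subset_integral => //.
  by case/integrableP : ig.
by move=> z zab; rewrite /= lee_fin (le_trans _ (fg z zab)).
Qed.

Lemma mean01E (R : realType) (g : R -> R) :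
  mean `[0, 1] g = \int[lebesgue_measure]_(x in `[0, 1]) g x.
Proof. by rewrite /mean lebesgue_measure_itv/= lte_fin ltr01 oppr0 addr0 invr1 mul1r. Qed.

Lemma Rintegral01_cst (R : realType) (c : R) :
  \int[lebesgue_measure]_(_ in `[0, 1]) c = c.
Proof.
rewrite Rintegral_cst//= lebesgue_measure_itv/= lte_fin ltr01.
by rewrite oppr0 addr0 mulr1.
Qed.

Lemma le_Rintegral_within (R : realType) (a b : R) (f g : R -> R) :
  {within `[a, b], continuous f} -> {within `[a, b], continuous g} ->
  (forall x, x \in `[a, b] -> f x <= g x) ->
  \int[lebesgue_measure]_(x in `[a, b]) f x <=
  \int[lebesgue_measure]_(x in `[a, b]) g x.
Proof.
move=> cf cg fg; apply: le_Rintegral => //; exact: within_itvcc_integrable.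
Qed.

(** The mean lies between the minimum and the maximum, and the intermediate value theorem applies
    between the points where these are reached. It supplies base points: one where [u] equals [M],
    one where [v] vanishes. *)
Lemma mean01_attained (R : realType) (g : R -> R) :
  {within `[0, 1], continuous g} ->
  exists2 c, c \in `[0, 1] & g c = mean `[0, 1] g.
Proof.
move=> cg; rewrite mean01E.
have [p p01 pmax] := EVT_max (@ler01 R) cg.
have [q q01 qmin] := EVT_min (@ler01 R) cg.
set m := \int[_]_(_ in _) _.
have mp : m <= g p.
  rewrite -[leRHS]Rintegral01_cst; apply: le_Rintegral_within => //.
  exact/continuous_subspaceT/cst_continuous.
have qm : g q <= m.
  rewrite -[leLHS]Rintegral01_cst; apply: le_Rintegral_within => //.
  exact/continuous_subspaceT/cst_continuous.
have main (a b : R) : a <= b -> a \in `[0, 1] -> b \in `[0, 1] ->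
    Num.min (g a) (g b) <= m <= Num.max (g a) (g b) ->
    exists2 c, c \in `[0, 1] & g c = m.
  rewrite !in_itv/= => ab /andP[a0 _] /andP[_ b1] /(IVT ab).
  have sub : `[a, b] `<=` `[0, 1].
    by move=> z/=; rewrite !in_itv/= => /andP[az zb]; lra.
  move=> /(_ (continuous_subspaceW sub cg))[c cab gc].
  by exists c => //; exact: sub.
case: (leP p q) => [pq|/ltW qp].
- by apply: main pq _ _ _ => //; rewrite ge_min qm le_max mp orbT.
- by apply: main qp _ _ _ => //; rewrite ge_min qm le_max mp !orbT.
Qed.

(** * Differentiation under the integral sign *)

(** Change of variable [h = y - x]; the right-hand form is that of [dx_quotient], so ordinary and
    one-sided space derivatives become comparable. *)
Lemma is_derive1P (R : realType) (f : R -> R) (x l : R) :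
  is_derive x 1 f l <-> (f y - f x) / (y - x) @[y --> x^'] --> l.
Proof.
have E (y : R) : (f y - f x) / (y - x) =
    (fun h : R => h^-1 *: ((f \o shift x) (h *: 1) - f x)) (y - x).
  by rewrite /= [_ *: 1]mulr1 subrK mulrC.
pose q (h : R) := h^-1 *: ((f \o shift x) (h *: 1) - f x).
suff main : q h @[h --> (0:R)^'] --> l <-> (f y - f x) / (y - x) @[y --> x^'] --> l.
  split=> [[df dl]|/main ql]; first by apply/main; rewrite -dl.
  have dfl : 'D_1 f x = l by exact: cvg_lim ql.
  by split => //; apply/cvg_ex; exists l.
split => /cvgrPdist_lt H; apply/cvgrPdist_lt => e /H.
- case=> d /= d0 He; exists d => //= y yd yx; rewrite E.
  apply: He; first by rewrite /= sub0r normrN distrC.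
  by rewrite subr_eq0.
- case=> d /= d0 He; exists d => //= h hd h0.
  have := He (h + x); rewrite E addrK; apply.
    by rewrite /= opprD addrCA subrr addr0 normrN -normrN -sub0r.
  by rewrite -subr_eq0 addrK.
Qed.

Lemma nbhs_times_oo (R : realType) (T : \bar R) (t : R) :
  times_oo T t -> nbhs t (times_oo T).
Proof.
move=> [t0 tT].
have [e e0 He] : exists2 e, 0 < e & (((t + e)%:E) < T)%E.
  case: T tT => [r| |] //=; last by exists 1; rewrite // ltry.
  by rewrite lte_fin => tr; exists ((r - t) / 2); rewrite ?lte_fin; lra.
exists (Num.min e t); first by rewrite /= lt_min e0 t0.
move=> s /=; rewrite lt_min => /andP[]; rewrite !ltr_distlC => /andP[_ se] /andP[st _].
by split; [lra | rewrite (lt_trans _ He)// lte_fin].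
Qed.

(** The mean value theorem with the intermediate point located by its distance to [t], so that [s]
    may lie on either side. *)
Lemma MVT_quotient (R : realType) (f df : R -> R) (s t : R) : s != t ->
  (forall z, `|t - z| <= `|t - s| -> is_derive z 1 f (df z)) ->
  exists2 c, `|t - c| <= `|t - s| & (f s - f t) / (s - t) = df c.
Proof.
move=> st dgs.
have key (a b : R) : a < b -> (forall z, z \in `[a, b] -> is_derive z 1 f (df z)) ->
    exists2 c, c \in `[a, b] & (f b - f a) / (b - a) = df c.
  move=> ab dab.
  have dM z : z \in `]a, b[ -> is_derive z 1 f (df z).
    by move=> zab; apply: dab; exact: subset_itv_oo_cc zab.
  have cM : {within `[a, b], continuous f}.
    by apply: derivable_within_continuous => z zab; have [] := dab z zab.
  have [c cab E] := MVT ab dM cM.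
  exists c; first exact: subset_itv_oo_cc cab.
  by rewrite E mulfK// subr_eq0 gt_eqF.
case: (ltgtP s t) st => // lt_st _.
- have [|c cs E] := key s t lt_st.
  + move=> z; rewrite in_itv/= => /andP[sz zt]; apply: dgs.
    by rewrite !ger0_norm ?subr_ge0// ?lerD2l ?lerN2// ltW.
  + exists c; last by rewrite -E -(opprB s t) -(opprB (f s)) invrN mulrNN.
    move: cs; rewrite in_itv/= => /andP[sz zt].
    by rewrite !ger0_norm ?subr_ge0// ?lerD2l ?lerN2// ltW.
- have [|c cs E] := key t s lt_st.
  + move=> z; rewrite in_itv/= => /andP[sz zt]; apply: dgs.
    by rewrite ![`|t - _|]distrC !ger0_norm ?subr_ge0// ?lerD2r// ltW.
  + exists c => //.
    move: cs; rewrite in_itv/= => /andP[sz zt].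
    by rewrite ![`|t - _|]distrC !ger0_norm ?subr_ge0// ?lerD2r// ltW.
Qed.

(** * Uniform convergence on [0, 1] from joint limits in time and space *)

Section strip.
Context {R : realType}.
Implicit Types (F : set_system R) (g : R -> R -> R) (h : R -> R).

(** The time filter is left free: [nbhs t] expresses joint continuity, [t^'] the convergence of
    difference quotients. In space, only points of [0, 1] count, which treats the endpoints like the
    others. *)
Definition strip_nbhs F (x : R) : set_system (R * R) :=
  filter_prod F (within `[0, 1] (nbhs x)).

#[export] Instance strip_nbhs_filter F (x : R) : Filter F -> Filter (strip_nbhs F x).
Proof. by move=> FF; exact: filter_prod_filter. Qed.

(** The set of times (0, T) is open, so the restriction to it is void near [t], and only the
    restriction in space remains. *)
Lemma continuous_on2_strip (T : \bar R) g t x :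
  continuous_on2 (times_oo T `*` `[0, 1]) g -> times_oo T t -> x \in `[0, 1] ->
  g p.1 p.2 @[p --> strip_nbhs (nbhs t) x] --> g t x.
Proof.
move=> /subspace_continuousP cg [t0 tT] x01; have := cg (t, x).
move=> /(_ (conj (conj t0 tT) x01)); apply: cvg_trans => A.
case=> [[P Q]/= [tP xQ] PQ].
have tJ := nbhs_times_oo R T t (conj t0 tT).
exists (P `&` times_oo T, Q `&` `[0, 1]) => /=; last first.
  by case=> s y [[/= Ps Js] [Qy Ay]]; apply: (PQ (s, y)).
by split; [exact: filterI|apply: filterS xQ => y Qy Ay; split].
Qed.


Lemma strip_continuous t g :
  (forall x, x \in `[0, 1] ->
    g p.1 p.2 @[p --> strip_nbhs (nbhs t) x] --> g t x) ->
  {within `[0, 1], continuous (g t)}.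
Proof.
move=> H; apply/subspace_continuousP => x x01.
have := H x x01; apply: cvg_trans => A [[P Q]/= [tP xQ] PQ].
apply: filterS xQ => y Qy.
exact: (PQ (t, y) (conj (nbhs_singleton tP) Qy)).
Qed.

(** Compactness of [0, 1], in its near-covering form, makes the joint limits at the individual
    points [x] uniform in [x]. *)
Lemma strip_uniform F g h : Filter F ->
  {within `[0, 1], continuous h} ->
  (forall x, x \in `[0, 1] -> g p.1 p.2 @[p --> strip_nbhs F x] --> h x) ->
  forall e, 0 < e ->
    \forall s \near F, forall x, x \in `[0, 1] -> `|h x - g s x| < e.
Proof.
move=> FF /subspace_continuousP ch gh e e0.
have /compact_near_coveringP/near_covering_withinP := @segment_compact R 0 1.
move=> /(_ R F (fun s x => `|h x - g s x| < e) FF); apply => x x01.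
have e20 : 0 < e / 2 by rewrite divr_gt0.
have /cvgrPdist_lt/(_ _ e20)[[P Q]/= [FP xQ] PQ] := gh x x01.
have /cvgrPdist_lt/(_ _ e20) hx := ch x x01.
exists ([set y | y \in `[0, 1] -> Q y /\ `|h x - h y| < e / 2], P) => /=.
  by split => //; apply: (filterI xQ hx).
move=> [y s]/= [+ Ps] y01 => /(_ y01)[Qy hxy].
have /= := PQ (s, y) (conj Ps Qy).
have : `|h y - g s y| <= `|h x - h y| + `|h x - g s y|.
  rewrite -[h x - h y]opprB normrN; apply: le_trans (ler_normD _ _).
  by rewrite subrKA.
lra.
Qed.

Lemma cvg_Rintegral_strip F g h : Filter F ->
  {within `[0, 1], continuous h} ->
  (\forall s \near F, {within `[0, 1], continuous (g s)}) ->
  (forall x, x \in `[0, 1] -> g p.1 p.2 @[p --> strip_nbhs F x] --> h x) ->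
  \int[lebesgue_measure]_(x in `[0, 1]) g s x @[s --> F] -->
  \int[lebesgue_measure]_(x in `[0, 1]) h x.
Proof.
move=> FF ch cg gh; apply/cvgrPdist_le => e e0.
near=> s.
have cgs : {within `[0, 1], continuous (g s)} by near: s.
have hg : forall x, x \in `[0, 1] -> `|h x - g s x| < e.
  by near: s; exact: strip_uniform.
have ih := within_itvcc_integrable _ _ _ _ ch.
have ig := within_itvcc_integrable _ _ _ _ cgs.
rewrite -RintegralB//.
have cd : {within `[0, 1], continuous (fun x => h x - g s x)}.
  by move=> x; apply: cvgB; [exact: ch|exact: cgs].
have id := within_itvcc_integrable _ _ _ _ cd.
apply: (le_trans (le_normr_Rintegral _ id)) => //.
rewrite -[leRHS]Rintegral01_cst; apply: le_Rintegral_within => //.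
- by move=> x; apply: cvg_norm; exact: cd.
- exact/continuous_subspaceT/cst_continuous.
- by move=> x x01; exact/ltW/hg.
Unshelve. all: by end_near. Qed.

(** The integrand [q] need not be the difference quotient of the integrand of [Phi]; only the
    integrals must agree. This leaves room for an integration by parts before the limit is taken. *)
Lemma is_derive_Rintegral_quotient (Phi : R -> R) (q : R -> R -> R) h t :
  {within `[0, 1], continuous h} ->
  (\forall s \near t^', {within `[0, 1], continuous (q s)}) ->
  (forall x, x \in `[0, 1] -> q p.1 p.2 @[p --> strip_nbhs t^' x] --> h x) ->
  (\forall s \near t^', Phi s - Phi t =
     (s - t) * \int[lebesgue_measure]_(x in `[0, 1]) q s x) ->
  is_derive t 1 Phi (\int[lebesgue_measure]_(x in `[0, 1]) h x).
Proof.
move=> ch cq qh Phiq; apply/is_derive1P.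
apply: cvg_trans (cvg_Rintegral_strip _ _ _ _ ch cq qh).
apply: near_eq_cvg; near=> s.
have st : s - t != 0 by rewrite subr_eq0; near: s; exact: nbhs_dnbhs_neq.
rewrite (near Phiq s)//; field.
by rewrite st.
Unshelve. all: by end_near. Qed.

(** At each [y] the quotient equals [gt] at an intermediate time, which depends on [y] but is no
    farther from [t] than [s] is. Joint continuity of [gt] is thus enough. *)
Lemma strip_difference_quotient g (gt : R -> R -> R) (t x : R) :
  (\forall s \near t, forall y : R, y \in `[0, 1] ->
    is_derive (s : R) (1 : R) (g^~ y) (gt s y)) ->
  gt p.1 p.2 @[p --> strip_nbhs (nbhs t) x] --> gt t x ->
  (g p.1 p.2 - g t p.2) / (p.1 - t) @[p --> strip_nbhs t^' x] --> gt t x.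
Proof.
move=> [d /= d0 dg] gtc; apply/cvgrPdist_lt => e e0.
have /cvgrPdist_lt/(_ _ e0)[[P Q]/= [[r /= r0 rP] xQ] PQ] := gtc.
exists ([set s | s != t /\ `|t - s| < Num.min d r], Q `&` `[0, 1]) => /=.
  split; last exact: filterI xQ (withinT _ _).
  by exists (Num.min d r) => [|s /= ? ?]; [rewrite /= lt_min d0|split].
move=> [s y] /= [[st std] [Qy y01]].
have {std} [td tr] : `|t - s| < d /\ `|t - s| < r by apply/andP; rewrite -lt_min.
have dgs z : `|t - z| <= `|t - s| -> is_derive z 1 (g^~ y) (gt z y).
  by move=> tz; apply: dg => //=; exact: le_lt_trans td.
have [c tc ->] := MVT_quotient R (g^~ y) (gt^~ y) s t st dgs.
by apply: (PQ (c, y)); split => /=; [apply: rP => /=; exact: le_lt_trans tr|exact: Qy].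
Qed.

End strip.

Lemma is_derive1M (R : realType) (f g : R -> R) (x a b : R) :
  is_derive x 1 f a -> is_derive x 1 g b ->
  is_derive x 1 (fun y => f y * g y) (a * g x + f x * b).
Proof.
move=> df dg; apply: is_derive_eq (is_deriveM df dg) _.
by rewrite addrC [f x *: b]/GRing.scale /= [g x *: a]/GRing.scale /= [g x * a]mulrC.
Qed.

Lemma is_derive1_compose (R : realType) (h f : R -> R) (x a b : R) :
  is_derive (f x) 1 h a -> is_derive x 1 f b ->
  is_derive x 1 (fun y => h (f y)) (a * b).
Proof. exact: is_derive1_comp. Qed.

(** * Derivatives of the scalar functions in the energy and the entropy *)

Section real_functions.
Context {R : realType}.
Implicit Type r : R.

Lemma is_derive1_Nsqrt_inv r : 0 < r ->
  is_derive r 1 (fun y => - 2 / Num.sqrt y) (r * Num.sqrt r)^-1.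
Proof.
move=> r0; have s0 : 0 < Num.sqrt r by rewrite sqrtr_gt0.
have ds := is_derive1_sqrt r0.
have D := is_deriveZ (- 2) (is_deriveV (lt0r_neq0 s0) ds).
apply: (is_derive_eq D).
rewrite /GRing.scale /=.
(* Replacing [r] by [s ^+ 2], with [s] its square root, leaves an identity of rational functions in
   [s]. *)
move: (esym (sqr_sqrtr (ltW r0))) s0; generalize (Num.sqrt r) => s -> s0.
by field; rewrite gt_eqF.
Qed.

Lemma is_derive1_inv_mul_sqrt r : 0 < r ->
  is_derive r 1 (fun y => (y * Num.sqrt y)^-1)
    (- (3 / 2) / (r ^+ 2 * Num.sqrt r)).
Proof.
move=> r0; have s0 : 0 < Num.sqrt r by rewrite sqrtr_gt0.
have ds := is_derive1_sqrt r0.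
have dm := is_derive1M _ id Num.sqrt _ _ _ (is_derive_id r 1) ds.
have rs0 : r * Num.sqrt r != 0 by rewrite mulf_neq0// gt_eqF.
have D := @is_deriveV R (fun y => y * Num.sqrt y) r _ _ rs0 dm.
apply: (is_derive_eq D).
rewrite /GRing.scale /=.
move: (esym (sqr_sqrtr (ltW r0))) s0; generalize (Num.sqrt r) => s -> s0.
by field; rewrite gt_eqF.
Qed.

Lemma is_derive1_mul_ln r : 0 < r ->
  is_derive r 1 (fun y => y * ln y) (ln r + 1).
Proof.
move=> r0.
apply: is_derive_eq (is_derive1M _ id _ _ _ _ (is_derive_id r 1) (is_derive1_ln r0)) _.
by rewrite mul1r divff// gt_eqF.
Qed.

End real_functions.

(** * Joint continuity on the strip and time derivatives of integrals *)

Section strip_continuity.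
Context {R : realType} (T : \bar R).
Implicit Type g : R -> R -> R.

(** Joint continuity is stated as a limit along [strip_nbhs], so that the limit rules for sums,
    products and compositions apply directly. *)
Definition strip_continuous_on g := forall t x : R, times_oo T t -> x \in `[0, 1] ->
  g p.1 p.2 @[p --> strip_nbhs (nbhs t) x] --> g t x.

Lemma strip_continuousN g : strip_continuous_on g ->
  strip_continuous_on (fun t x => - g t x).
Proof. by move=> cg t x tT x01; apply: cvgN; exact: cg. Qed.

Lemma strip_continuousD g g' : strip_continuous_on g -> strip_continuous_on g' ->
  strip_continuous_on (fun t x => g t x + g' t x).
Proof. by move=> cg cg' t x tT x01; apply: cvgD; [exact: cg|exact: cg']. Qed.

Lemma strip_continuousB g g' : strip_continuous_on g -> strip_continuous_on g' ->
  strip_continuous_on (fun t x => g t x - g' t x).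
Proof. by move=> cg cg' t x tT x01; apply: cvgB; [exact: cg|exact: cg']. Qed.

Lemma strip_continuousM g g' : strip_continuous_on g -> strip_continuous_on g' ->
  strip_continuous_on (fun t x => g t x * g' t x).
Proof. by move=> cg cg' t x tT x01; apply: cvgM; [exact: cg|exact: cg']. Qed.

Lemma strip_continuous_cst (c : R) : strip_continuous_on (fun _ _ => c).
Proof. by move=> t x _ _; exact: cvg_cst. Qed.

Lemma strip_continuous_comp (h : R -> R) g :
  (forall r, 0 < r -> {for r, continuous h}) ->
  (forall t x, times_oo T t -> x \in `[0, 1] -> 0 < g t x) ->
  strip_continuous_on g -> strip_continuous_on (fun t x => h (g t x)).
Proof.
move=> ch g0 cg t x tT x01; apply: (continuous_cvg _ (ch _ (g0 t x tT x01))).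
exact: cg.
Qed.

Lemma strip_continuousW g t : strip_continuous_on g -> times_oo T t ->
  {within `[0, 1], continuous (g t)}.
Proof. by move=> cg tT; apply: strip_continuous => x x01; exact: cg. Qed.

Lemma strip_cvg_dnbhs g (t x l : R) :
  g p.1 p.2 @[p --> strip_nbhs (nbhs t) x] --> l ->
  g p.1 p.2 @[p --> strip_nbhs t^' x] --> l.
Proof.
apply: cvg_trans => A [[P Q]/= [tP xQ] PQ].
by exists (P, Q) => //; split => //; exact: nbhs_dnbhs.
Qed.

Lemma strip_cvg_snd (F : set_system R) (h : R -> R) (x : R) : Filter F ->
  x \in `[0, 1] -> {within `[0, 1], continuous h} ->
  h p.2 @[p --> strip_nbhs F x] --> h x.
Proof.
move=> FF x01 /subspace_continuousP/(_ x x01); apply: cvg_comp.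
exact: cvg_snd.
Qed.

Lemma is_derive_Rintegral_strip g gt t :
  strip_continuous_on g -> strip_continuous_on gt ->
  (forall s x : R, times_oo T s -> x \in `[0, 1] ->
    is_derive s (1 : R) (g^~ x) (gt s x)) ->
  times_oo T t ->
  is_derive t 1 (fun s => \int[lebesgue_measure]_(x in `[0, 1]) g s x)
    (\int[lebesgue_measure]_(x in `[0, 1]) gt t x).
Proof.
move=> cg cgt dg tT.
have ct := strip_continuousW _ _ cg tT.
apply: (is_derive_Rintegral_quotient _ (fun s x => (g s x - g t x) / (s - t))).
- exact: strip_continuousW.
- near=> s.
  have sT : times_oo T s by near: s; apply: nbhs_dnbhs; exact: nbhs_times_oo.
  have cs := strip_continuousW _ _ cg sT.
  by move=> x; apply: cvgMr_tmp; apply: cvgB; [exact: cs|exact: ct].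
- move=> x x01; apply: strip_difference_quotient; last exact: cgt.
  by apply: filterS (nbhs_times_oo _ _ _ tT) => s sT y y01; exact: dg.
- near=> s.
  have sT : times_oo T s by near: s; apply: nbhs_dnbhs; exact: nbhs_times_oo.
  have st : s - t != 0 by rewrite subr_eq0; near: s; exact: nbhs_dnbhs_neq.
  have cs := strip_continuousW _ _ cg sT.
  have cd : {within `[0, 1], continuous (fun x => g s x - g t x)}.
    by move=> x; apply: cvgB; [exact: cs|exact: ct].
  rewrite RintegralZr//; last exact: within_itvcc_integrable.
  rewrite RintegralB//; [|exact: within_itvcc_integrable..].
  by rewrite mulrC divfK.
Unshelve. all: by end_near. Qed.

(* Integrating [(w s - w t) * (wx s + wx t)] by parts turns the increment of
   the energy into an integral without mixed derivatives of [w]. *)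
Lemma is_derive_energy (w wt wx wxx : R -> R -> R) t :
  strip_continuous_on w -> strip_continuous_on wt ->
  strip_continuous_on wx -> strip_continuous_on wxx ->
  (forall s x : R, times_oo T s -> x \in `[0, 1] ->
    is_derive s (1 : R) (w^~ x) (wt s x)) ->
  (forall s x : R, times_oo T s -> x \in `]0, 1[ ->
    is_derive x (1 : R) (w s) (wx s x)) ->
  (forall s x : R, times_oo T s -> x \in `]0, 1[ ->
    is_derive x (1 : R) (wx s) (wxx s x)) ->
  (forall s : R, times_oo T s -> wx s 0 = 0 /\ wx s 1 = 0) ->
  times_oo T t ->
  is_derive t 1 (fun s => \int[lebesgue_measure]_(x in `[0, 1]) (wx s x ^+ 2 / 2))
    (\int[lebesgue_measure]_(x in `[0, 1]) (- (wt t x * wxx t x))).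
Proof.
move=> cw cwt cwx cwxx dtw dw dwx bc tT.
have cwt' := strip_continuousW _ _ cw tT.
have cwxxt := strip_continuousW _ _ cwxx tT.
have cE s : times_oo T s -> {within `[0, 1], continuous (fun x => wx s x ^+ 2 / 2)}.
  move=> sT.
  have cs := strip_continuousW _ _ cwx sT.
  by move=> x; apply: cvgMr_tmp; apply: cvgM; exact: cs.
pose q s x := - ((w s x - w t x) / (s - t) * ((wxx s x + wxx t x) / 2)).
have cq s : times_oo T s -> {within `[0, 1], continuous (q s)}.
  move=> sT x; apply: cvgN; apply: cvgM; apply: cvgMr_tmp.
    by apply: cvgB; [exact: strip_continuousW cw sT x|exact: cwt'].
  by apply: cvgD; [exact: strip_continuousW cwxx sT x|exact: cwxxt].
apply: (is_derive_Rintegral_quotient _ q).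
- by move=> x; apply: cvgN; apply: cvgM; [exact: strip_continuousW cwt tT x|exact: cwxxt].
- near=> s; apply: cq.
  by near: s; apply: nbhs_dnbhs; exact: nbhs_times_oo.
- move=> x x01; apply: cvgN; apply: cvgM.
    apply: strip_difference_quotient; last exact: cwt.
    by apply: filterS (nbhs_times_oo _ _ _ tT) => s sT y y01; exact: dtw.
  rewrite [X in _ --> X](_ : _ = (wxx t x + wxx t x) / 2); last by field.
  apply: cvgMr_tmp; apply: cvgD; last exact: strip_cvg_snd.
  by apply: strip_cvg_dnbhs; exact: cwxx.
- near=> s.
  have sT : times_oo T s by near: s; apply: nbhs_dnbhs; exact: nbhs_times_oo.
  have st : s - t != 0 by rewrite subr_eq0; near: s; exact: nbhs_dnbhs_neq.
  have csE := cE s sT; have ctE := cE t tT; have cqs := cq s sT.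
  rewrite -RintegralB//; [|exact: within_itvcc_integrable..].
  rewrite -RintegralZl//; last exact: within_itvcc_integrable.
  apply/eqP; rewrite -subr_eq0; apply/eqP.
  have cZ : {within `[0, 1], continuous (fun x => (s - t) * q s x)}.
    by move=> x; apply: cvgMl_tmp; exact: cqs.
  have cB : {within `[0, 1], continuous (fun x => wx s x ^+ 2 / 2 - wx t x ^+ 2 / 2)}.
    by move=> x; apply: cvgB; [exact: csE|exact: ctE].
  rewrite -RintegralB//; [|exact: within_itvcc_integrable..].
  (* [P] is the boundary term of the integration by parts. Its derivative is the difference of the
     two integrands to be compared, and it vanishes at 0 and 1 because [wx] does. *)
  pose P x := (w s x - w t x) * (2^-1 * (wx s x + wx t x)).
  have cD : {within `[0, 1], continuous (fun x =>
      (wx s x ^+ 2 / 2 - wx t x ^+ 2 / 2) - (s - t) * q s x)}.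
    by move=> x; apply: cvgB; [exact: cB|exact: cZ].
  have cP : {within `[0, 1], continuous P}.
    move=> x; apply: cvgM; [apply: cvgB|apply: cvgMl_tmp; apply: cvgD].
    + exact: strip_continuousW cw sT x.
    + exact: strip_continuousW cw tT x.
    + exact: strip_continuousW cwx sT x.
    + exact: strip_continuousW cwx tT x.
  have dP (x : R) : x \in `]0, 1[ -> is_derive x 1 P
      ((wx s x ^+ 2 / 2 - wx t x ^+ 2 / 2) - (s - t) * q s x).
    move=> x01.
    have d1 := is_deriveB (dw s x sT x01) (dw t x tT x01).
    have d2 := is_deriveZ (2^-1) (is_deriveD (dwx s x sT x01) (dwx t x tT x01)).
    have D := is_derive1M _ _ _ _ _ _ d1 d2.
    apply: (is_derive_eq D).
    by rewrite /q /= /GRing.scale /= !fctE; field.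
  have -> := Rintegral_is_derive _ _ _ _ _ ltr01 cD cP dP.
  have [w0 w1] := bc s sT; have [v0 v1] := bc t tT.
  by rewrite /P w0 w1 v0 v1 !addr0 !mulr0 subrr.
Unshelve. all: by end_near. Qed.

End strip_continuity.

(** * The Lyapunov functional *)

(** The first integrand is [f'^2 / (2 f^3)], written as half the square of the derivative of
    [-2 / sqrt f], the form in which [is_derive_energy] handles it. *)
Definition lyapunov {R : realType} (f f' : R -> R) : R :=
  \int[lebesgue_measure]_(x in `[0, 1])
    ((f' x * (f x * Num.sqrt (f x))^-1) ^+ 2 / 2) -
  \int[lebesgue_measure]_(x in `[0, 1]) (f x * ln (f x)).

Section lyapunov_decay.
Context {R : realType} (T : \bar R) (M : R) (u ut ux uxx V : R -> R -> R).
Hypotheses (cu : strip_continuous_on T u) (cut : strip_continuous_on T ut)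
  (cux : strip_continuous_on T ux) (cuxx : strip_continuous_on T uxx)
  (cV : strip_continuous_on T V).
Hypothesis u_gt0 : forall t x, times_oo T t -> x \in `[0, 1] -> 0 < u t x.
Hypothesis dtu : forall t x : R, times_oo T t -> x \in `[0, 1] ->
  is_derive t (1 : R) (u^~ x) (ut t x).
Hypothesis dxu : forall t x : R, times_oo T t -> x \in `]0, 1[ ->
  is_derive x (1 : R) (u t) (ux t x).
Hypothesis dxux : forall t x : R, times_oo T t -> x \in `]0, 1[ ->
  is_derive x (1 : R) (ux t) (uxx t x).
Hypothesis dxV : forall t x : R, times_oo T t -> x \in `]0, 1[ ->
  is_derive x (1 : R) (V t) (M - u t x).
Hypothesis bcu : forall t, times_oo T t -> ux t 0 = 0 /\ ux t 1 = 0.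
Hypothesis bcV : forall t, times_oo T t -> V t 0 = 0 /\ V t 1 = 0.
Hypothesis pde : forall t x, times_oo T t -> x \in `]0, 1[ ->
  ut t x = uxx t x / u t x - ux t x ^+ 2 / u t x ^+ 2 - ux t x * V t x
           - u t x * (M - u t x).

(** [k] is the derivative of [-2 / sqrt r] and [k'] that of [k]; by the chain rule [wt], [wx], [wxx]
    below are then the derivatives of [w]. *)
Let k (r : R) := (r * Num.sqrt r)^-1.
Let k' (r : R) := - (3 / 2) / (r ^+ 2 * Num.sqrt r).
Let w t x := - 2 / Num.sqrt (u t x).
Let wt t x := k (u t x) * ut t x.
Let wx t x := ux t x * k (u t x).
Let wxx t x := uxx t x * k (u t x) + ux t x * (k' (u t x) * ux t x).

Let sqrt_gt0 (r : R) : 0 < r -> Num.sqrt r != 0.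
Proof. by move=> r0; rewrite gt_eqF// sqrtr_gt0. Qed.

Let ck : strip_continuous_on T (fun t x => k (u t x)).
Proof.
apply: strip_continuous_comp => // r r0.
apply: cvgV; first by rewrite mulf_neq0 ?gt_eqF ?sqrtr_gt0.
by apply: cvgM; [exact: cvg_id|exact: sqrt_continuous].
Qed.

Let ck' : strip_continuous_on T (fun t x => k' (u t x)).
Proof.
apply: strip_continuous_comp => // r r0.
apply: cvgMl_tmp; apply: cvgV.
  by rewrite mulf_neq0 ?expf_neq0 ?gt_eqF ?sqrtr_gt0.
apply: cvgM; [|exact: sqrt_continuous].
by apply: cvgM; exact: cvg_id.
Qed.

Let cw : strip_continuous_on T w.
Proof.
apply: (strip_continuous_comp _ (fun r => - 2 / Num.sqrt r)) => // r r0.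
by apply: cvgMl_tmp; apply: cvgV; [exact: sqrt_gt0|exact: sqrt_continuous].
Qed.

Let cwt : strip_continuous_on T wt. Proof. exact: strip_continuousM. Qed.

Let cwx : strip_continuous_on T wx. Proof. exact: strip_continuousM. Qed.

Let cwxx : strip_continuous_on T wxx.
Proof.
exact: (strip_continuousD _ _ _ (strip_continuousM _ _ _ cuxx ck)
  (strip_continuousM _ _ _ cux (strip_continuousM _ _ _ ck' cux))).
Qed.

Let cln : strip_continuous_on T (fun t x => ln (u t x)).
Proof. by apply: strip_continuous_comp => // r; exact: continuous_ln. Qed.

Let S t x := u t x * ln (u t x).
Let entropy_t t x := (ln (u t x) + 1) * ut t x.

Let centropy_t : strip_continuous_on T entropy_t.
Proof.
exact: (strip_continuousM _ _ _
  (strip_continuousD _ _ _ cln (strip_continuous_cst _ 1)) cut).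
Qed.

Let is_derive_lyapunov t : times_oo T t ->
  is_derive t 1 (fun s => lyapunov (u s) (ux s))
   (\int[lebesgue_measure]_(x in `[0, 1]) (- (wt t x * wxx t x)) -
    \int[lebesgue_measure]_(x in `[0, 1]) ((ln (u t x) + 1) * ut t x)).
Proof.
move=> tT.
have dtw (s x : R) : times_oo T s -> x \in `[0, 1] ->
    is_derive s (1 : R) (w^~ x) (wt s x).
  move=> sT x01; have us0 := u_gt0 s x sT x01.
  exact: (is_derive1_compose _ (fun r => - 2 / Num.sqrt r) (u^~ x) s _ _
    (is_derive1_Nsqrt_inv _ us0) (dtu s x sT x01)).
have dxw (s x : R) : times_oo T s -> x \in `]0, 1[ ->
    is_derive x (1 : R) (w s) (wx s x).
  move=> sT x01; have us0 := u_gt0 s x sT (subset_itv_oo_cc x01).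
  rewrite /wx mulrC.
  exact: (is_derive1_compose _ (fun r => - 2 / Num.sqrt r) (u s) x _ _
    (is_derive1_Nsqrt_inv _ us0) (dxu s x sT x01)).
have dxwx (s x : R) : times_oo T s -> x \in `]0, 1[ ->
    is_derive x (1 : R) (wx s) (wxx s x).
  move=> sT x01; have us0 := u_gt0 s x sT (subset_itv_oo_cc x01).
  have dk := is_derive1_compose _ k (u s) x _ _
    (is_derive1_inv_mul_sqrt _ us0) (dxu s x sT x01).
  exact: (is_derive1M _ (ux s) (fun y => k (u s y)) _ _ _ (dxux s x sT x01) dk).
have bcw (s : R) : times_oo T s -> wx s 0 = 0 /\ wx s 1 = 0.
  by move=> sT; rewrite /wx; have [-> ->] := bcu s sT; rewrite !mul0r.
have dE := is_derive_energy T w wt wx wxx t cw cwt cwx cwxx dtw dxw dxwx bcw tT.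
have dtS (s x : R) : times_oo T s -> x \in `[0, 1] ->
    is_derive s (1 : R) (S^~ x) (entropy_t s x).
  move=> sT x01; have us0 := u_gt0 s x sT x01.
  exact: (is_derive1_compose _ (fun r => r * ln r) (u^~ x) s _ _
    (is_derive1_mul_ln _ us0) (dtu s x sT x01)).
have dS := is_derive_Rintegral_strip T S entropy_t t
  (strip_continuousM _ _ _ cu cln) centropy_t dtS tT.
exact: is_deriveB dE dS.
Qed.

(* [u * K] is the flux; the derivative of the Lyapunov function is
   [- \int (K_x)^2]. *)
Let K t x := ux t x / u t x ^+ 2 - V t x.
Let Kx t x := uxx t x / u t x ^+ 2 - 2 * ux t x ^+ 2 / u t x ^+ 3 - (M - u t x).
(** Put [E = wxx * k(u) + ln u + 1], which is minus the variational derivative of the functional.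
    Then [G = u * E - Kx], and the x-derivative of [G] is [E * ux]. Since [ut = ux * K + u * Kx], it
    follows that [E * ut] is the x-derivative of [K * G] plus [Kx ^+ 2]. *)
Let G t x := ux t x ^+ 2 / (2 * u t x ^+ 3) + u t x * ln (u t x) + M.
Let Phi t x := K t x * G t x.

Let is_derive_K (t x : R) : times_oo T t -> x \in `]0, 1[ ->
  is_derive x (1 : R) (K t) (Kx t x).
Proof.
move=> tT x01; have u0 := u_gt0 t x tT (subset_itv_oo_cc x01).
have du := dxu t x tT x01.
have d2 := is_derive1M _ _ _ _ _ _ du du.
have uu : u t x * u t x != 0 by rewrite mulf_neq0 ?gt_eqF.
have di := @is_deriveV R (fun y => u t y * u t y) x _ _ uu d2.
have D := is_deriveB (is_derive1M _ _ _ _ _ _ (dxux t x tT x01) di) (dxV t x tT x01).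
apply: (is_derive_eq D).
rewrite /Kx /GRing.scale /=; field.
by rewrite gt_eqF.
Qed.

Let is_derive_G (t x : R) : times_oo T t -> x \in `]0, 1[ ->
  is_derive x (1 : R) (G t)
   (ux t x * uxx t x / u t x ^+ 3 - 3 / 2 * ux t x ^+ 3 / u t x ^+ 4 +
    (ln (u t x) + 1) * ux t x).
Proof.
move=> tT x01; have u0 := u_gt0 t x tT (subset_itv_oo_cc x01).
have du := dxu t x tT x01.
have d2 := is_derive1M _ _ _ _ _ _ du du.
have d3 := is_deriveZ 2 (is_derive1M _ _ _ _ _ _ du d2).
have uu : (2 \*: (fun y => u t y * (u t y * u t y)) : R -> R) x != 0.
  by rewrite /= /GRing.scale/= !mulf_neq0 ?gt_eqF.
have di := @is_deriveV R _ x _ _ uu d3.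
have dx2 := is_derive1M _ _ _ _ _ _ (dxux t x tT x01) (dxux t x tT x01).
have d4 := is_derive1M _ _ _ _ _ _ dx2 di.
have d5 := is_derive1_compose _ (fun r => r * ln r) (u t) x _ _
  (is_derive1_mul_ln _ u0) du.
have D := is_deriveD (is_deriveD d4 d5) (is_derive_cst M x (1:R)).
apply: (is_derive_eq D).
rewrite /GRing.scale /= /GRing.scale /=; field.
by rewrite gt_eqF.
Qed.

Let lyapunov_derive_le0 t : times_oo T t ->
  \int[lebesgue_measure]_(x in `[0, 1]) (- (wt t x * wxx t x)) -
  \int[lebesgue_measure]_(x in `[0, 1]) ((ln (u t x) + 1) * ut t x) <= 0.
Proof.
move=> tT.
have cA : {within `[0, 1], continuous (fun x => - (wt t x * wxx t x))}.
  apply: (strip_continuousW T (fun t x => - (wt t x * wxx t x))) => //.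
  exact: (strip_continuousN _ _ (strip_continuousM _ _ _ cwt cwxx)).
have cB := strip_continuousW _ _ _ centropy_t tT.
have cAB : {within `[0, 1], continuous (fun x => - (wt t x * wxx t x) - entropy_t t x)}.
  by move=> x; apply: cvgB; [exact: cA|exact: cB].
have cinv2 : strip_continuous_on T (fun t x => (u t x ^+ 2)^-1).
  apply: (strip_continuous_comp _ (fun r => (r ^+ 2)^-1)) => // r r0.
  apply: cvgV; first by rewrite expf_neq0// gt_eqF.
  by apply: cvgM; exact: cvg_id.
have cinv3 : strip_continuous_on T (fun t x => (u t x ^+ 3)^-1).
  apply: (strip_continuous_comp _ (fun r => (r ^+ 3)^-1)) => // r r0.
  apply: cvgV; first by rewrite expf_neq0// gt_eqF.
  by exact: exprn_continuous.
have c2inv3 : strip_continuous_on T (fun t x => (2 * u t x ^+ 3)^-1).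
  apply: (strip_continuous_comp _ (fun r => (2 * r ^+ 3)^-1)) => // r r0.
  apply: cvgV; first by rewrite mulf_neq0// expf_neq0// gt_eqF.
  by apply: cvgMl_tmp; exact: exprn_continuous.
have cux2 := strip_continuousM _ _ _ cux cux.
have cK : strip_continuous_on T K.
  exact: (strip_continuousB _ _ _ (strip_continuousM _ _ _ cux cinv2) cV).
have cKx : strip_continuous_on T Kx.
  exact: (strip_continuousB _ _ _
    (strip_continuousB _ _ _ (strip_continuousM _ _ _ cuxx cinv2)
      (strip_continuousM _ _ _
        (strip_continuousM _ _ _ (strip_continuous_cst _ 2) cux2) cinv3))
    (strip_continuousB _ _ _ (strip_continuous_cst _ M) cu)).
have cG : strip_continuous_on T G.
  exact: (strip_continuousD _ _ _
    (strip_continuousD _ _ _ (strip_continuousM _ _ _ cux2 c2inv3)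
      (strip_continuousM _ _ _ cu cln)) (strip_continuous_cst _ M)).
(* [I] is [- E * ut], so [I + Kx ^+ 2] is the x-derivative of [- Phi]. Its integral is zero because
   [ux] and [V], hence [K], vanish at both endpoints. *)
pose I x := - (wt t x * wxx t x) - entropy_t t x.
rewrite -RintegralB//; [|exact: within_itvcc_integrable..].
have cI : {within `[0, 1], continuous (fun x => I x + Kx t x ^+ 2)}.
  have ck2 := strip_continuousW _ _ _ (strip_continuousM _ _ _ cKx cKx) tT.
  by move=> x; apply: cvgD; [exact: cAB|exact: ck2].
have cPhi : {within `[0, 1], continuous (- Phi t)}.
  have cP := strip_continuousW _ _ _ (strip_continuousM _ _ _ cK cG) tT.
  by move=> x; apply: cvgN; exact: cP.
have dPhi (x : R) : x \in `]0, 1[ -> is_derive x 1 (- Phi t) (I x + Kx t x ^+ 2).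
  move=> x01; have u0 := u_gt0 t x tT (subset_itv_oo_cc x01).
  have D := is_deriveN (is_derive1M _ _ _ _ _ _ (is_derive_K t x tT x01)
    (is_derive_G t x tT x01)).
  apply: (is_derive_eq D).
  rewrite /I /wt /wxx /entropy_t /Kx /K /G /k /k' pde//.
  have := sqr_sqrtr (ltW u0); have := sqrt_gt0 _ u0.
  generalize (ln (u t x)) => L; move: u0.
  generalize (u t x) (ux t x) (uxx t x) (V t x) => f f1 f2 v f0.
  generalize (Num.sqrt f) => s s0 sf; rewrite -sf in f0 *.
  by field.
have E := Rintegral_is_derive _ _ _ _ _ ltr01 cI cPhi dPhi.
apply: (@le_trans _ _ (\int[lebesgue_measure]_(x in `[0, 1]) (I x + Kx t x ^+ 2))).
  by apply: le_Rintegral_within => // x _; rewrite lerDl sqr_ge0.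
rewrite E /Phi /K -[(- _) 1]/(- _) -[(- _) 0]/(- _).
have [-> ->] := bcu t tT; have [-> ->] := bcV t tT.
by rewrite !mul0r !subr0 !mul0r subrr.
Qed.

Lemma lyapunov_nincr s t : times_oo T s -> times_oo T t -> s <= t ->
  lyapunov (u t) (ux t) <= lyapunov (u s) (ux s).
Proof.
move=> [s0 sT] [t0 tT] st.
have inT (r : R) : r \in `[s, t] -> times_oo T r.
  rewrite in_itv/= => /andP[sr rt]; split; first exact: lt_le_trans sr.
  by rewrite (le_lt_trans _ tT)// lee_fin.
have D (r : R) : r \in `[s, t] -> is_derive r 1 (fun s => lyapunov (u s) (ux s)) _ :=
  fun rst => is_derive_lyapunov r (inT r rst).
apply: (@ler0_derive1_le_cc R (fun s => lyapunov (u s) (ux s)) s t) => //.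
- by move=> r rst; have [] := D r (subset_itv_oo_cc rst).
- move=> r rst; rewrite derive1E.
  have [_ ->] := D r (subset_itv_oo_cc rst).
  exact/lyapunov_derive_le0/inT/subset_itv_oo_cc.
- by apply: derivable_within_continuous => r rst; have [] := D r rst.
- by rewrite in_itv/= lexx st.
- by rewrite in_itv/= lexx st.
Qed.

End lyapunov_decay.

(** The weights in AM-GM are tuned to the mean: [D] is given the factor [(2 * M)^-1], which
    integration against [f], of total mass [M], turns into [D / 2]. This is strictly less than the
    [D] present in the functional, so [D <= 2 * (C + M * ln M + M ^+ 3)]; inserting it in [b] gives
    the stated constant. *)
Lemma ln_dist_mean_le (R : realType) (M C : R) (f f' : R -> R) : 0 < M ->
  {within `[0, 1], continuous f} -> {within `[0, 1], continuous f'} ->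
  (forall x, x \in `[0, 1] -> 0 < f x) ->
  (forall x : R, x \in `]0, 1[ -> is_derive x (1 : R) f (f' x)) ->
  mean `[0, 1] f = M -> lyapunov f f' <= C ->
  forall x, x \in `[0, 1] ->
    `|ln (f x) - ln M| <= (C + M * ln M + M ^+ 3) / M + M ^+ 2.
Proof.
move=> M0 cf cf' f0 df fM fC.
pose a x := f' x * (f x * Num.sqrt (f x))^-1.
pose e x := a x ^+ 2 / 2.
have cfg (h : R -> R) : (forall r, 0 < r -> {for r, continuous h}) ->
    {within `[0, 1], continuous (fun x => h (f x))}.
  move=> ch; apply/subspace_continuousP => x x01.
  apply: (continuous_cvg _ (ch _ (f0 x x01))).
  exact: (subspace_continuousP _ _).1 cf x x01.
have cln := cfg _ (@continuous_ln R).
have cinv : {within `[0, 1], continuous (fun x => (f x)^-1)}.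
  by apply: (cfg (fun r => r^-1)) => r r0; apply: cvgV; [rewrite gt_eqF|exact: cvg_id].
have ca : {within `[0, 1], continuous a}.
  have ck : {within `[0, 1], continuous (fun x => (f x * Num.sqrt (f x))^-1)}.
    apply: (cfg (fun r => (r * Num.sqrt r)^-1)) => r r0.
    apply: cvgV; first by rewrite mulf_neq0 ?gt_eqF ?sqrtr_gt0.
    by apply: cvgM; [exact: cvg_id|exact: sqrt_continuous].
  by move=> x; apply: cvgM; [exact: cf'|exact: ck].
have ce : {within `[0, 1], continuous e}.
  by move=> x; apply: cvgMr_tmp; apply: cvgM; exact: ca.
have cfl : {within `[0, 1], continuous (fun x => f x * ln (f x))}.
  by move=> x; apply: cvgM; [exact: cf|exact: cln].
have cq : {within `[0, 1], continuous (fun x => f' x / f x)}.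
  by move=> x; apply: cvgM; [exact: cf'|exact: cinv].
have c1 : {within `[0, 1], continuous (fun x => (2 * M)^-1 * e x)}.
  by move=> x; apply: cvgMl_tmp; exact: ce.
have c2 : {within `[0, 1], continuous (fun x => M * f x)}.
  by move=> x; apply: cvgMl_tmp; exact: cf.
have c12 : {within `[0, 1], continuous (fun x => (2 * M)^-1 * e x + M * f x)}.
  by move=> x; apply: cvgD; [exact: c1|exact: c2].
set D := \int[lebesgue_measure]_(x in `[0, 1]) e x.
have fM' : \int[lebesgue_measure]_(x in `[0, 1]) f x = M by rewrite -mean01E.
pose b := (2 * M)^-1 * D + M * M.
have gb : \int[lebesgue_measure]_(x in `[0, 1]) ((2 * M)^-1 * e x + M * f x) = b.
  rewrite RintegralD//; [|exact: within_itvcc_integrable..].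
  rewrite RintegralZl//; last exact: within_itvcc_integrable.
  rewrite RintegralZl//; last exact: within_itvcc_integrable.
  by rewrite fM'.
have dln (y : R) : y \in `]0, 1[ ->
    is_derive y (1 : R) (fun x => ln (f x)) (f' y / f y).
  move=> y01; rewrite mulrC.
  have fy0 := f0 y (subset_itv_oo_cc y01).
  exact: (is_derive1_compose _ (@ln R) f y _ _ (is_derive1_ln fy0) (df y y01)).
(* AM-GM: [|a| s <= a^2 / (4 M) + M s^2] with [s = sqrt f] *)
have dln_le (y : R) : y \in `[0, 1] ->
    `|f' y / f y| <= (2 * M)^-1 * e y + M * f y.
  move=> y01; have fy0 := f0 y y01.
  have -> : f' y / f y = a y * Num.sqrt (f y).
    have s0 : 0 < Num.sqrt (f y) by rewrite sqrtr_gt0.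
    by rewrite /a; field; rewrite !gt_eqF.
  rewrite normrM (ger0_norm (sqrtr_ge0 _)) /e.
  rewrite -[in leRHS](sqr_sqrtr (ltW fy0)) -(real_normK (num_real (a y))).
  move: `|a y| (Num.sqrt _) => p s; rewrite -subr_ge0.
  have -> : (2 * M)^-1 * (p ^+ 2 / 2) + M * s ^+ 2 - p * s =
            (4 * M)^-1 * (p - 2 * M * s) ^+ 2 by field; rewrite gt_eqF.
  by rewrite mulr_ge0 ?sqr_ge0// invr_ge0 mulr_ge0// ltW.
have fb x : x \in `[0, 1] -> `|ln (f x) - ln M| <= b.
  (* The base point [x0] satisfies [f x0 = M], so [ln M] is a value of [ln f]. *)
  move=> x01; have [x0 x001] := mean01_attained _ _ cf.
  rewrite fM => <-; rewrite -gb.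
  exact: (dist_le_Rintegral_derive _ _ _ _ _ _ ltr01 cln cq c12 dln dln_le).
have cr : {within `[0, 1], continuous (fun x => (ln M + b) * f x)}.
  by move=> x; apply: cvgMl_tmp; exact: cf.
have Sle : \int[lebesgue_measure]_(x in `[0, 1]) (f x * ln (f x)) <= (ln M + b) * M.
  have <- : \int[lebesgue_measure]_(x in `[0, 1]) ((ln M + b) * f x) = (ln M + b) * M.
    by rewrite RintegralZl ?fM'//; exact: within_itvcc_integrable.
  apply: (le_Rintegral_within _ _ _ _ _ cfl cr) => x x01.
  rewrite mulrC ler_wpM2r//; first exact/ltW/f0.
  by have := fb x x01; rewrite ler_distl => /andP[_]; rewrite addrC.
have DC : D <= 2 * (C + M * ln M + M ^+ 3).
  move: fC; rewrite /lyapunov -/(e _) -/D => fC.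
  have : D <= C + (ln M + b) * M by lra.
  have -> : (ln M + b) * M = M * ln M + M ^+ 3 + D / 2.
    by rewrite /b; field; rewrite gt_eqF.
  lra.
move=> x x01; apply: (le_trans (fb x x01)).
rewrite /b -expr2 lerD2r ler_pdivlMr//.
have -> : (2 * M)^-1 * D * M = D / 2 by field; rewrite gt_eqF.
by rewrite ler_pdivrMr// mulrC.
Qed.

(** * One-sided space derivatives *)

Section space_derivative.
Context {R : realType}.
Implicit Types (f g h : R -> R) (x l : R).

(** Every point of [0, 1] has room 1/2 inside the interval on at least one side. Properness gives
    uniqueness of the limit that defines [dx]. *)
Lemma dnbhs_within01_proper x : x \in `[0, 1] ->
  ProperFilter (within `[0, 1] x^').
Proof.
rewrite in_itv/= => /andP[x0 x1]; split; last exact: within_filter.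
move=> [e /= e0 He].
pose d := Num.min (e / 2) (1 / 2).
have d0 : 0 < d by rewrite lt_min !divr_gt0.
have de : d <= e / 2 by rewrite ge_min lexx.
have d1 : d <= 1 / 2 by rewrite ge_min lexx orbT.
case: (leP x (1 / 2)) => x12.
- apply: (He (x + d)).
  + by rewrite /= opprD addNKr normrN gtr0_norm//; lra.
  + by rewrite gt_eqF// ltrDl.
  + by rewrite /= in_itv/=; lra.
- apply: (He (x - d)).
  + by rewrite /= opprB addrC subrK gtr0_norm//; lra.
  + by rewrite lt_eqF// ltrBlDr ltrDl.
  + by rewrite /= in_itv/=; lra.
Qed.

Lemma dx_cvgE f x l : x \in `[0, 1] ->
  dx_quotient f x @ within `[0, 1] x^' --> l -> dx f x = l.
Proof. by move=> x01; have F := dnbhs_within01_proper _ x01; exact: cvg_lim. Qed.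

Lemma is_derive1_dx f x : x \in `]0, 1[ -> x_derivable f x ->
  is_derive x (1 : R) f (dx f x).
Proof.
move=> x01 df; apply/is_derive1P; apply: cvg_trans df => A /= Ax.
have near01 : \forall y \near x^', y \in `[0, 1].
  apply: nbhs_dnbhs; apply: filterS (near_in_itvoo x01) => y.
  exact: subset_itv_oo_cc.
by apply: (filterS2 _ _ near01 Ax) => y y01 Ay; exact: Ay.
Qed.

(** Agreement on [0, 1] is all that [dx] sees. It allows [a (u t y)] to be replaced by the inverse
    of [u t y], an equality known only where [u] is positive. *)
Lemma dx_is_derive1 f g x l : x \in `]0, 1[ ->
  {in `[0, 1], f =1 g} -> is_derive x (1 : R) g l -> dx f x = l.
Proof.
move=> x01 fg /is_derive1P gl; apply: dx_cvgE; first exact: subset_itv_oo_cc.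
have x01' := subset_itv_oo_cc x01.
have : (g y - g x) / (y - x) @[y --> within `[0, 1] x^'] --> l.
  exact: cvg_within_filter.
apply: cvg_trans.
apply: near_eq_cvg; near=> y.
rewrite /dx_quotient !fg//.
by near: y; exact: near_withinT.
Unshelve. all: by end_near. Qed.

(** A chain rule that includes the endpoints, where the condition on [A \o u] has to become one on
    [u]. *)
Lemma dx_comp h f x l : x \in `[0, 1] -> x_derivable f x ->
  is_derive (f x) (1 : R) h l -> dx (h \o f) x = l * dx f x.
Proof.
move=> x01 df /is_derive1P dh; apply: dx_cvgE => //.
(* The quotient of [h] is extended continuously by [l] at [f x], since [f y] may equal [f x] for [y]
   arbitrarily close to [x]. *)
pose phi (z : R) := if z == f x then l else (h z - h (f x)) / (z - f x).
have cphi : phi z @[z --> f x] --> phi (f x).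
  apply/continuous_withinNx; rewrite {2}/phi eqxx.
  apply: cvg_trans dh; apply: near_eq_cvg; near=> z.
  rewrite /phi ifF//; apply/negbTE; near: z; exact: nbhs_dnbhs_neq.
have neqx : \forall y \near within `[0, 1] x^', y != x.
  exact: cvg_within (nbhs_dnbhs_neq x).
have cf : f y @[y --> within `[0, 1] x^'] --> f x.
  have : dx_quotient f x y * (y - x) + f x @[y --> within `[0, 1] x^'] -->
      dx f x * (x - x) + f x.
    apply: cvgD; last exact: cvg_cst.
    apply: cvgM; first exact: df.
    apply: cvgB; last exact: cvg_cst.
    by apply: cvg_within_filter; apply: cvg_trans (@nbhs_dnbhs _ x) _.
  rewrite subrr mulr0 add0r; apply: cvg_trans.
  apply: near_eq_cvg; near=> y.
  have yx : y - x != 0 by rewrite subr_eq0; near: y.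
  by rewrite /dx_quotient divfK// subrK.
have : phi (f y) * dx_quotient f x y @[y --> within `[0, 1] x^'] -->
    phi (f x) * dx f x.
  by apply: cvgM; [exact: cvg_comp cf cphi|exact: df].
rewrite {2}/phi eqxx; apply: cvg_trans; apply: near_eq_cvg; near=> y.
rewrite /phi /dx_quotient /=; case: eqP => [->|/eqP fyx].
  by rewrite !subrr mul0r mulr0.
by rewrite mulrA divfK// subr_eq0.
Unshelve. all: by end_near. Qed.

End space_derivative.

(** * Time sections, essential bounds and measurability *)

Lemma continuous_on2_section (R : realType) (J : set R) (g : R -> R -> R) (t : R) :
  continuous_on2 (J `*` `[0, 1]) g -> J t -> {within `[0, 1], continuous (g t)}.
Proof.
move=> /subspace_continuousP cg Jt; apply/subspace_continuousP => x x01.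
have := cg (t, x) (conj Jt x01); apply: cvg_trans => A [[P Q]/= [tP xQ] PQ].
apply: filterS xQ => y Qy y01.
exact: (PQ (t, y) (conj (nbhs_singleton tP) Qy) (conj Jt y01)).
Qed.

(** The hypothesis [0 <= C] covers the points outside [D], where the extended function is 0. *)
Lemma Linf_norm_le (R : realType) (V : normedModType R) (D : set R)
    (f : R -> V) (C : R) : 0 <= C -> (forall x, D x -> `|f x| <= C) ->
  (Linf_norm D f <= C%:E)%E.
Proof.
move=> C0 fC; rewrite /Linf_norm unlock; case: ifPn => _; last by rewrite lee_fin.
apply/ess_supP; apply: nearW => x /=.
rewrite lee_fin patchE; case: ifPn => [|_]; last by rewrite normr0.
by rewrite inE => Dx; rewrite normr_id; exact: fC.
Qed.

Lemma measurable_fun_pair_within (d : measure_display) (T : measurableType d)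
    (R : realType) (D : set T) (f g : T -> R) :
  measurable D -> measurable_fun D f -> measurable_fun D g ->
  measurable_fun D (fun x => (f x, g x)).
Proof.
move=> mD /(measurable_restrictT _ mD) mf /(measurable_restrictT _ mD) mg.
apply: eq_measurable_fun (measurable_funTS (measurable_fun_pair mf mg)) => x xD.
by rewrite !patchE xD.
Qed.

(** * Bounds for classical solutions *)

Lemma classical_solution_lyapunov_nincr (R : realType) (a A : R -> R) (M : R)
    (u0 : R -> R) (T : \bar R) (u v : R -> R -> R) :
  (forall r : R, 0 < r -> a r = 1 / r) -> indefinite_integral a A ->
  C12 T u -> C12 T v -> solves_SP a A M u0 T u v ->
  (forall t x : R, times_oo T t -> x \in `[0, 1] -> 0 < u t x) ->
  forall s t : R, times_oo T s -> times_oo T t -> s <= t ->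
  lyapunov (u t) (dx (u t)) <= lyapunov (u s) (dx (u s)).
Proof.
move=> ha hA [du [cu cut cux cuxx]] [dv [_ _ cvx _]] [pde bc _ _] ugt0.
have strip g : continuous_on2 (times_oo T `*` `[0, 1]) g -> strip_continuous_on T g.
  by move=> cg t x tT x01; exact: continuous_on2_strip cg tT x01.
have dxu (t x : R) : times_oo T t -> x \in `]0, 1[ ->
    is_derive x (1 : R) (u t) (dx (u t) x).
  move=> tT x01; have [_ d _] := du t x (conj tT (subset_itv_oo_cc x01)).
  exact: is_derive1_dx.
have dxux (t x : R) : times_oo T t -> x \in `]0, 1[ ->
    is_derive x (1 : R) (dx (u t)) (dx (dx (u t)) x).
  move=> tT x01; have [_ _ d] := du t x (conj tT (subset_itv_oo_cc x01)).
  exact: is_derive1_dx.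
have dxV (t x : R) : times_oo T t -> x \in `]0, 1[ ->
    is_derive x (1 : R) (dx (v t)) (M - u t x).
  move=> tT x01; have [_ _ d] := dv t x (conj tT (subset_itv_oo_cc x01)).
  have [_ vxx] := pde t x tT x01.
  have -> : M - u t x = dx (dx (v t)) x by lra.
  exact: is_derive1_dx.
have dtu (t x : R) : times_oo T t -> x \in `[0, 1] ->
    is_derive t (1 : R) (u^~ x) (dt u t x).
  move=> tT x01; have [d _ _] := du t x (conj tT x01).
  by split => //; rewrite /dt derive1E.
(* The derivative of [A] at [u] is [1 / u], which is not zero, so the no-flux condition on [A \o u]
   forces [dx (u t)] to vanish at the ends. *)
have bcu (t : R) : times_oo T t -> dx (u t) 0 = 0 /\ dx (u t) 1 = 0.
  move=> tT; have [bc0 bc1 _ _] := bc t tT.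
  have key (x : R) : x \in `[0, 1] -> dx (A \o u t) x = 0 -> dx (u t) x = 0.
    move=> x01; have [_ d _] := du t x (conj tT x01).
    have ux0 := ugt0 t x tT x01.
    rewrite (dx_comp _ _ _ _ x01 d (hA _ ux0)) ha// mul1r => /eqP.
    by rewrite mulf_eq0 invr_eq0 gt_eqF//= => /eqP.
  by split; apply: key => //; rewrite in_itv/= ?lexx ?ler01.
have bcV (t : R) : times_oo T t -> dx (v t) 0 = 0 /\ dx (v t) 1 = 0.
  by move=> tT; have [_ _ ? ?] := bc t tT.
have pdeE (t x : R) : times_oo T t -> x \in `]0, 1[ ->
    dt u t x = dx (dx (u t)) x / u t x - dx (u t) x ^+ 2 / u t x ^+ 2
      - dx (u t) x * dx (v t) x - u t x * (M - u t x).
  move=> tT x01; have [-> _] := pde t x tT x01.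
  have ux0 := ugt0 t x tT (subset_itv_oo_cc x01).
  have di := @is_deriveV R (u t) x _ _ (lt0r_neq0 ux0) (dxu t x tT x01).
  have d1 := is_derive1M _ _ _ _ _ _ di (dxux t x tT x01).
  have d2 := is_derive1M _ _ _ _ _ _ (dxu t x tT x01) (dxV t x tT x01).
  apply: (dx_is_derive1 _ _ _ _ x01 _ (is_derive_eq (is_deriveB d1 d2) _)).
    by move=> y y01; rewrite ha ?ugt0// mul1r.
  rewrite /GRing.scale /=; field.
  by rewrite gt_eqF.
exact: (lyapunov_nincr T M u (dt u) (fun t => dx (u t)) (fun t => dx (dx (u t)))
  (fun t => dx (v t)) (strip _ cu) (strip _ cut) (strip _ cux) (strip _ cuxx)
  (strip _ cvx) ugt0 dtu dxu dxux dxV bcu bcV pdeE).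
Qed.

(** The interval of existence is cut at some positive time [t0]. After [t0] the functional is
    available and gives bounds uniform in [t]. Up to [t0] the upper bound is compactness, and the
    lower bound is the explicit one, which decays in time but is used only as far as [t0]. Nothing
    depends on whether [T] is finite. *)
Lemma classical_solution_bounds (R : realType) (a A : R -> R) (M m0 : R)
    (u0 : R -> R) (T : \bar R) (u v : R -> R -> R) :
  (forall r : R, 0 < r -> a r = 1 / r) -> indefinite_integral a A ->
  0 < M -> 0 < m0 < M ->
  maximal_classical_solution a A M m0 u0 T u v ->
  exists2 c : R, 0 < c & exists C : R, forall t x : R, times_co T t ->
    x \in `[0, 1] -> c <= u t x <= C.
Proof.
move=> ha hA M0 /andP[m00 m0M] [T0 [cu _ Cu Cv] sol lb _].
pose b t := M * m0 / (m0 + expR (M * t) * (M - m0)).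
have den_gt0 t : 0 < m0 + expR (M * t) * (M - m0).
  by rewrite addr_gt0// mulr_gt0 ?expR_gt0// subr_gt0.
have b_gt0 t : 0 < b t by rewrite divr_gt0// mulr_gt0.
have coo t : times_oo T t -> times_co T t by move=> [t0 tT]; split => //; exact: ltW.
have ugt0 (t x : R) : times_oo T t -> x \in `[0, 1] -> 0 < u t x.
  move=> tT x01; have [_ /(_ x x01)] := lb t (coo t tT).
  exact: (lt_le_trans (b_gt0 t)).
have lyap := classical_solution_lyapunov_nincr _ _ _ _ _ _ _ _ ha hA Cu Cv sol ugt0.
have [t0 [t00 t0T]] : exists t0, times_oo T t0.
  case: T T0 {cu Cu Cv sol lb ugt0 lyap coo} => [r| |]//.
    rewrite lte_fin => r0; exists (r / 2); split; first by rewrite divr_gt0.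
    by rewrite lte_fin; lra.
  by move=> _; exists 1; split; rewrite ?ltry.
(* The constant of [ln_dist_mean_le], with the value of the functional at [t0] as [C]. *)
pose B := (lyapunov (u t0) (dx (u t0)) + M * ln M + M ^+ 3) / M + M ^+ 2.
have late (t x : R) : times_oo T t -> t0 <= t -> x \in `[0, 1] ->
    M * expR (- B) <= u t x <= M * expR B.
  move=> tT t0t x01; have [du [_ _ cux _]] := Cu.
  have [meanu _] := lb t (coo t tT).
  have : `|ln (u t x) - ln M| <= B.
    apply: (ln_dist_mean_le _ M _ (u t) (dx (u t))) => //.
    - exact: continuous_on2_section cu (coo t tT).
    - exact: continuous_on2_section cux tT.
    - by move=> y y01; exact: ugt0.
    - move=> y y01; apply: is_derive1_dx => //.
      by have [] := du t y (conj tT (subset_itv_oo_cc y01)).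
    - exact: lyap.
  have ux0 := ugt0 t x tT x01.
  have -> : M * expR (- B) = expR (ln M - B) by rewrite expRD lnK.
  have -> : M * expR B = expR (ln M + B) by rewrite expRD lnK.
  by rewrite ler_distl -[X in _ -> _ <= X <= _]lnK// !ler_expR.
have [Z Zb] : exists Z, forall t x : R, 0 <= t <= t0 -> x \in `[0, 1] -> u t x <= Z.
  have sub : `[0, t0] `*` `[(0 : R), 1] `<=` times_co T `*` `[0, 1].
    move=> [t x] [+ x01]; rewrite /= in_itv/= => /andP[tge0 tt0]; split => //.
    by split => //; rewrite (le_lt_trans _ t0T)// lee_fin.
  have cQ := continuous_subspaceW sub cu.
  have cptQ : compact (`[0, t0] `*` `[0, 1] : set (R * R)).
    by apply: compact_setX; exact: segment_compact.
  have Q0 : (`[0, t0] `*` `[0, 1] : set (R * R)) !=set0.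
    by exists (0, 0); split => /=; rewrite in_itv/= lexx ?ler01// ltW.
  have [[p1 p2] _ pmax] := compact_EVT_max Q0 cptQ cQ.
  exists (u p1 p2) => t x t0t x01; apply: (pmax (t, x)).
  by rewrite inE; split => //=; rewrite in_itv.
exists (Num.min (b t0) (M * expR (- B))).
  by rewrite lt_min b_gt0/= mulr_gt0// expR_gt0.
exists (Num.max Z (M * expR B)) => t x [tge0 tT] x01.
case: (leP t t0) => [tt0|/ltW t0t].
- rewrite ge_min le_max (Zb t x) ?tge0//=.
  have [_ /(_ x x01)] := lb t (conj tge0 tT).
  rewrite andbT => /(le_trans _) ->//.
  rewrite /b ler_pM2l; last exact: mulr_gt0.
  rewrite lef_pV2 ?posrE// lerD2l ler_pM2r ?subr_gt0//.
  by rewrite ler_expR ler_pM2l.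
- have tT' : times_oo T t by split => //; exact: lt_le_trans t0t.
  have /andP[l1 l2] := late t x tT' t0t x01.
  by rewrite ge_min le_max l1 l2 !orbT.
Qed.

(** The second space derivative [M - u] is at most [M + C] in absolute value. Integrating from 0,
    where [dx (v t)] vanishes, and then from a zero of [v t], provided by its zero mean, keeps the
    same constant since the interval has length 1. *)
Lemma classical_solution_potential_bound (R : realType) (a A : R -> R)
    (M m0 : R) (u0 : R -> R) (T : \bar R) (u v : R -> R -> R) (C : R) : 0 < M ->
  maximal_classical_solution a A M m0 u0 T u v ->
  (forall t x : R, times_co T t -> x \in `[0, 1] -> 0 <= u t x <= C) ->
  exists D : R, forall t x : R, times_co T t -> x \in `[0, 1] -> `|v t x| <= D.
Proof.
move=> M0 [T0 [cu cv Cu Cv] [pde bc _ meanv] _ _] uC.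
have T00 : times_co T 0 by [].
(* The equations for [v] are known only at positive times; at time 0 continuity on [0, 1] gives the
   bound. *)
have [z _ zmax] : exists2 z, z \in `[0, 1] & forall x, x \in `[0, 1] -> `|v 0 x| <= `|v 0 z|.
  apply: (EVT_max (f := fun x => `|v 0 x|)) => //.
  by move=> x; apply: cvg_norm; exact: continuous_on2_section cv T00 x.
exists (Num.max (M + C) `|v 0 z|) => t x [t0 tT] x01; rewrite le_max.
move: t0; rewrite le_eqVlt => /predU1P[<-|t0]; first by rewrite zmax ?orbT.
have tJ : times_oo T t by [].
have tI : times_co T t by split => //; exact: ltW.
apply/orP; left.
have [dv [_ _ cvx cvxx]] := Cv.
have cvt := continuous_on2_section _ _ _ _ cv tI.
have cvxt := continuous_on2_section _ _ _ _ cvx tJ.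
have cvxxt := continuous_on2_section _ _ _ _ cvxx tJ.
have cut := continuous_on2_section _ _ _ _ cu tI.
have cMu : {within `[0, 1], continuous (fun x => M - u t x)}.
  by move=> y; apply: cvgB; [exact: cvg_cst|exact: cut].
have cC : {within `[0, 1], continuous (fun _ : R => M + C)}.
  exact/continuous_subspaceT/cst_continuous.
have [bv0 _] : dx (v t) 0 = 0 /\ dx (v t) 1 = 0 by have [] := bc t tJ.
have I0 : (0 : R) \in `[0, 1] by rewrite in_itv/= lexx ler01.
have dvxx (y : R) : y \in `]0, 1[ -> is_derive y (1 : R) (dx (v t)) (M - u t y).
  move=> y01; have [_ _ d] := dv t y (conj tJ (subset_itv_oo_cc y01)).
  have [_ E] := pde t y tJ y01.
  have -> : M - u t y = dx (dx (v t)) y by lra.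
  exact: is_derive1_dx.
have dvx (y : R) : y \in `]0, 1[ -> is_derive y (1 : R) (v t) (dx (v t) y).
  move=> y01; have [_ d _] := dv t y (conj tJ (subset_itv_oo_cc y01)).
  exact: is_derive1_dx.
have MuC (y : R) : y \in `[0, 1] -> `|M - u t y| <= M + C.
  by move=> y01; have /andP[u_ge0 u_le] := uC t y tI y01; rewrite ler_norml; lra.
have vx_le (y : R) : y \in `[0, 1] -> `|dx (v t) y| <= M + C.
  move=> y01; have := dist_le_Rintegral_derive _ _ _ _ _ _ ltr01 cvxt cMu cC
    dvxx MuC y 0 y01 I0.
  by rewrite bv0 subr0 Rintegral01_cst.
have [y y01 vy0] := mean01_attained _ _ cvt.
have := dist_le_Rintegral_derive _ _ _ _ _ _ ltr01 cvt cvxt cC dvx vx_le x y x01 y01.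
by rewrite vy0 meanv// subr0 Rintegral01_cst.
Qed.

Theorem theorem6 (R : realType) (a A : R -> R)
  (ha : forall r : R, 0 < r -> a r = 1 / r)
  (hA : indefinite_integral a A)
  (M : R) (hM : 0 < M)
  (m0 : R) (hm0 : 0 < m0 < M)
  (u0 : R -> R)
  (hu0_cont : {within `[0, 1], continuous u0})
  (hu0_nonneg : forall x : R, x \in `[0, 1] -> 0 <= u0 x)
  (hu0_ge : forall x : R, x \in `[0, 1] -> m0 <= u0 x)
  (hu0_mean : mean `[0, 1] u0 = M)
  (Tmax : \bar R) (u v : R -> R -> R)
  (huv : maximal_classical_solution a A M m0 u0 Tmax u v) :
  [/\ Tmax = +oo%E,
      bounded_in_Linf `]0, 1[
        [set (fun x => (u t x, v t x)) | t in `[0, +oo[]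
    & exists2 mu : R, 0 < mu &
        forall t x : R, 0 <= t -> x \in `[0, 1] -> mu <= u t x].
Proof.
have [c c0 [C ucC]] := classical_solution_bounds _ _ _ _ _ _ _ _ _ ha hA hM hm0 huv.
have uC (t x : R) : times_co Tmax t -> x \in `[0, 1] -> 0 <= u t x <= C.
  by move=> tT x01; have /andP[cu ->] := ucC t x tT x01; rewrite (le_trans (ltW c0)).
have [T0 [cu cv _ _] _ _ blowup] := huv.
have C0 : 0 <= C.
  have I0 : (0 : R) \in `[0, 1] by rewrite in_itv/= lexx ler01.
  have T00 : times_co Tmax 0 by [].
  by have /andP[/le_trans] := uC 0 0 T00 I0; exact.
(* If [Tmax] were finite, the norm of [u t] would exceed [C] just before it, against the bound [C]
   valid at all times of existence. *)
have Tinfty : Tmax = +oo%E.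
  case: Tmax T0 uC blowup {huv ucC cu cv} => [r|//|//]; rewrite lte_fin => r0 uC.
  rewrite ltry => /(_ isT) /= blowup; exfalso.
  have near_co : \forall t \near r^'-, times_co r%:E t.
    near=> t; split; first by apply: ltW; near: t; exact: nbhs_left_gt.
    by rewrite lte_fin; near: t; exact: nbhs_left_lt.
  have near_lt : \forall t \near r^'-, (C%:E < Linf_norm `](0%R : R), 1%R[ (u t))%E.
    by move/cvgeyPgt : blowup; apply.
  have near_false : \forall t \near r^'-, False.
    apply: filterS2 near_co near_lt => t tT; apply/negP; rewrite -leNgt.
    apply: Linf_norm_le => // x x01.
    have /andP[? ?] := uC t x tT (subset_itv_oo_cc x01).
    by rewrite ger0_norm.
  by have [] := filter_ex near_false.
have inT (t : R) : 0 <= t -> times_co Tmax t by move=> t0; rewrite Tinfty; split; rewrite ?ltry.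
have [D vD] := classical_solution_potential_bound _ _ _ _ _ _ _ _ _ _ hM huv uC.
split => //; last first.
  by exists c => // t x t0 x01; have /andP[] := ucC t x (inT t t0) x01.
exists (Num.max C D) => f [t]; rewrite /= in_itv/= andbT => t0 <-.
have tT := inT t t0; split.
  have sub : `]0, 1[ `<=` `[(0 : R), 1] by move=> y; exact: subset_itv_oo_cc.
  apply: measurable_fun_pair_within => //;
    apply: subspace_continuous_measurable_fun => //;
    apply: continuous_subspaceW sub _.
  - exact: continuous_on2_section cu tT.
  - exact: continuous_on2_section cv tT.
apply: Linf_norm_le => [|x /subset_itv_oo_cc x01]; first by rewrite le_max C0.
have /andP[u_ge0 u_le] := uC t x tT x01.
(* The norm of a pair is the maximum of the two norms, which explains the constant [Num.max C D]. *)
rewrite prod_normE/= ge_max !le_max (vD t x tT x01) orbT andbT.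
by rewrite ger0_norm// u_le.
Unshelve. all: by end_near. Qed.
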